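(* For every integer $n\ge 2$, the generalized $q$-Morgan-Voyce polynomials with arbitrary initial values $M_0(x,q)$, $M_1(x,q)$ satisfy $$M_{n}(x,q)=M_{0}(x,q)A_{n}(x,q)+M_{1}(x,q)E_{n}(x,q),$$ where $$A_{n}(x,q)=\sum_{j=0}^{\left\lfloor \frac{n-2}{2}\right\rfloor}(-1)^{j+1}\binom{n-j-2}{j}_{q}(x+1+q)^{n-2j-2}q^{j(j+1)},$$ $$E_{n}(x,q)=\sum_{j=0}^{\left\lfloor \frac{n-1}{2}\right\rfloor}(-1)^{j}\binom{n-j-1}{j}_{q}(x+1+q)^{n-2j-1}q^{j^{2}}.$$
   Context: Here $x,q$ are complex numbers with $q\neq 1$. The generalized $q$-Morgan-Voyce polynomials are defined, for arbitrary initial values $M_0(x,q)$, $M_1(x,q)$, by $M_{n}(x,q)=(x+1+q)M_{n-1}(x,q)-q^{n-2}M_{n-2}(x,q)$ for $n\ge 2$. The $q$-binomial coefficient is $\binom{n}{j}_q=\frac{[n]_q!}{[j]_q!\,[n-j]_q!}$ for $0\le j\le n$, with $[n]_q=1+q+\dots+q^{n-1}$, $[n]_q!=[n]_q[n-1]_q\cdots[1]_q$, $[0]_q!=1$; it is a polynomial in $q$ (and is understood as the value of this polynomial). Convention: $0^0=1$. *)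

(* Defs.v *)
From mathcomp Require Import all_boot all_order all_algebra.

Set Implicit Arguments.
Unset Strict Implicit.
Unset Printing Implicit Defensive.

Import GRing.Theory.

Local Open Scope ring_scope.

(* [n]_q and [n]_q! as polynomials in the indeterminate q = 'X. *)
Definition qint (F : fieldType) (n : nat) : {poly F} := \sum_(i < n) 'X^i.

Definition qfact (F : fieldType) (n : nat) : {poly F} :=
  \prod_(1 <= i < n.+1) qint F i.

(* Polynomial division %/ is exact here for j <= n. The quotient is taken in
   {poly F} before evaluation, so the value is meaningful also when q is a root
   of unity, where [j]_q! [n-j]_q! may vanish. *)
Definition qbinom (F : fieldType) (n j : nat) (q : F) : F :=
  (qfact F n %/ (qfact F j * qfact F (n - j))).[q].

(* The recurrence at index n >= 2 is indexed here by n = k.+2. *)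
Fixpoint qMorganVoyce (F : fieldType) (M0 M1 : F -> F -> F) (n : nat)
    (x q : F) {struct n} : F :=
  match n with
  | 0 => M0 x q
  | k'.+1 =>
    match k' with
    | 0 => M1 x q
    | k.+1 => (x + 1 + q) * qMorganVoyce M0 M1 k' x q
              - q ^+ k * qMorganVoyce M0 M1 k x q
    end
  end.

Definition qMV_A (F : fieldType) (n : nat) (x q : F) : F :=
  \sum_(0 <= j < ((n - 2) %/ 2).+1)
    (-1) ^+ (j + 1) * qbinom (n - j - 2) j q
    * (x + 1 + q) ^+ (n - 2 * j - 2) * q ^+ (j * (j + 1)).

Definition qMV_E (F : fieldType) (n : nat) (x q : F) : F :=
  \sum_(0 <= j < ((n - 1) %/ 2).+1)
    (-1) ^+ j * qbinom (n - j - 1) j q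
    * (x + 1 + q) ^+ (n - 2 * j - 1) * q ^+ (j ^ 2).

(* Main.v *)
Require Import Defs.
From mathcomp Require Import all_boot all_order all_algebra.
From mathcomp Require Import reals complex.
From mathcomp Require Import zify ring.

Import GRing.Theory.

Local Open Scope ring_scope.

(** Both coefficient families are, up to sign and a shift of [n], the sums
    [\sum_j (-1)^j [n-j choose j]_q y^(n-2j) q^(j(j+s))] with [y = x + 1 + q],
    where [s = 0] gives [E] and [s = 1] gives [A].  The [q]-Pascal rule
    [[n+1-j, j+1] = [n-j, j+1] + q^(n-2j) [n-j, j]] turns such a sum into a
    solution of [S (n+2) = y S (n+1) - q^(n+1+s) S n], which is the recurrence
    of the polynomials [M]. *)

(** Gaussian binomials by the [q]-Pascal rule: free of division, hence meaningful at roots of unity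
    and equally for [q = 'X] in [{poly F}]. *)
Fixpoint gauss_binom {R : nzRingType} (q : R) (n k : nat) {struct n} : R :=
  match n, k with
  | _, 0 => 1
  | 0, _.+1 => 0
  | m.+1, j.+1 => gauss_binom q m j.+1 + q ^+ (m - j) * gauss_binom q m j
  end.

Section GaussBinom.
Variable R : nzRingType.
Implicit Types q : R.

Lemma gauss_binom0 q n : gauss_binom q n 0 = 1.
Proof. by case: n. Qed.

Lemma gauss_binomS q n k :
  gauss_binom q n.+1 k.+1
  = gauss_binom q n k.+1 + q ^+ (n - k) * gauss_binom q n k.
Proof. by []. Qed.

Lemma gauss_binom_small q n k : (n < k)%N -> gauss_binom q n k = 0.
Proof.
elim: n k => [|n IHn] [|k] // ltnk.
by rewrite gauss_binomS !IHn ?mulr0 ?addr0 // ltnW.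
Qed.

Lemma gauss_binomnn q n : gauss_binom q n n = 1.
Proof.
elim: n => // n IHn.
by rewrite gauss_binomS gauss_binom_small // IHn subnn add0r mulr1.
Qed.

End GaussBinom.

Lemma horner_gauss_binom (R : comNzRingType) (q : R) n k :
  (gauss_binom 'X n k).[q] = gauss_binom q n k.
Proof.
elim: n k => [|n IHn] [|k]; rewrite ?gauss_binom0 /= ?hornerE //.
by rewrite !IHn.
Qed.

Section QFactorial.
Variable F : fieldType.

Lemma qint_split m n : qint F (m + n) = qint F m + 'X^m * qint F n.
Proof.
rewrite /qint big_split_ord /= mulr_sumr; congr (_ + _).
by apply: eq_bigr => i _; rewrite exprD.
Qed.

Lemma qfact0 : qfact F 0 = 1.
Proof. by rewrite /qfact big_nil. Qed.

Lemma qfactS n : qfact F n.+1 = qfact F n * qint F n.+1.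
Proof. by rewrite /qfact big_nat_recr. Qed.

Lemma qint_neq0 n : qint F n.+1 != 0.
Proof.
(* The constant coefficient of [[n+1]_q] is 1, so evaluation at 0 refutes vanishing. *)
apply/negP => /eqP /(congr1 (fun p : {poly F} => p.[0])) /eqP.
rewrite -add1n qint_split /qint big_ord1 !hornerE.
by rewrite oner_eq0.
Qed.

Lemma qfact_neq0 n : qfact F n != 0.
Proof.
elim: n => [|n IHn]; first by rewrite qfact0 oner_neq0.
by rewrite qfactS mulf_neq0 ?qint_neq0.
Qed.

(** Induction on [m + n]: the splitting [[m+n+2] = [n+1] + 'X^(n+1) [m+1]] of the last factor
    matches the two summands of the Pascal rule. *)
Lemma qfact_gauss_binom m n :
  qfact F (m + n) = gauss_binom 'X (m + n) m * (qfact F m * qfact F n).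
Proof.
have [k] := ubnP (m + n); elim: k m n => // k IHk [|m] [|n] ltk.
- by rewrite gauss_binom0 qfact0 !mul1r.
- by rewrite add0n gauss_binom0 qfact0 !mul1r.
- by rewrite addn0 gauss_binomnn qfact0 mulr1 mul1r.
have subE : (m + n.+1 - m = n.+1)%N by lia.
have qintE : qint F (m + n.+1).+1 = qint F n.+1 + 'X^(n.+1) * qint F m.+1.
  by rewrite -qint_split; congr (qint F _); lia.
have Em := IHk m n.+1 ltac:(lia).
have En := IHk m.+1 n ltac:(lia); rewrite addSnnS in En.
rewrite addSn gauss_binomS subE qfactS qintE mulrDr {1}En Em.
by rewrite !qfactS; ring.
Qed.

(** The product formula makes the polynomial division exact, and the divisor is nonzero in
    [{poly F}] even if its value at [q] is zero. *)
Lemma qbinomE n j (q : F) : (j <= n)%N -> qbinom n j q = gauss_binom q n j.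
Proof.
move=> lejn; rewrite /qbinom -{1}(subnKC lejn) qfact_gauss_binom.
by rewrite mulpK ?mulf_neq0 ?qfact_neq0 // subnKC // horner_gauss_binom.
Qed.

End QFactorial.

Section FibonacciSum.
Variables (R : comNzRingType) (y q : R) (s : nat).

Definition qfib_term n j : R :=
  (-1) ^+ j * gauss_binom q (n - j) j * y ^+ (n - 2 * j) * q ^+ (j * (j + s)).

(** The range goes past [n / 2], where the terms vanish, so that shifting the index needs no parity
    distinction. *)
Definition qfib n : R := \sum_(j < n.+1) qfib_term n j.

Lemma qfib_term_small n j : (n < 2 * j)%N -> qfib_term n j = 0.
Proof.
by move=> ltnj; rewrite /qfib_term gauss_binom_small ?mulr0 ?mul0r //; lia.
Qed.

Lemma qfib_half n : \sum_(0 <= j < (n %/ 2).+1) qfib_term n j = qfib n.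
Proof.
rewrite /qfib -(big_mkord xpredT (qfib_term n)).
rewrite [RHS](@big_cat_nat _ _ _ (n %/ 2).+1) //=; last lia.
rewrite [X in _ = _ + X]big_nat_cond [X in _ = _ + X]big1 ?addr0 // => j.
by move=> /andP[/andP[lej _] _]; rewrite qfib_term_small //; lia.
Qed.

Lemma qfib0 : qfib 0 = 1.
Proof. by rewrite /qfib big_ord1 /qfib_term !mulr1. Qed.

Lemma qfib1 : qfib 1 = y.
Proof.
rewrite /qfib big_ord_recr big_ord1 /= (qfib_term_small 1 1) // addr0.
by rewrite /qfib_term /= mulr1 !mul1r.
Qed.

Lemma qfib_termS n j : (j <= n)%N ->
  qfib_term n.+2 j.+1
  = y * qfib_term n.+1 j.+1 - q ^+ (n.+1 + s) * qfib_term n j.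
Proof.
move=> lejn; case: (ltnP n (2 * j)) => hj.
  by rewrite !qfib_term_small ?mulr0 ?subr0 //; lia.
rewrite {1}/qfib_term.
have -> : (n.+2 - j.+1 = (n - j).+1)%N by lia.
have -> : (n.+2 - 2 * j.+1 = n - 2 * j)%N by lia.
have subE : (n - j - j = n - 2 * j)%N by lia.
rewrite gauss_binomS subE mulrDr !mulrDl; congr (_ + _).
  (* Here [n = 2 * j]: the truncated exponent of [y] would be off by one, but both sides are
     zero. *)
  case: (ltnP n.+1 (2 * j.+1)) => hj1.
    rewrite qfib_term_small // gauss_binom_small; last lia.
    by rewrite !mulr0 !mul0r.
  rewrite /qfib_term subSS.
  have -> : (n - 2 * j = (n.+1 - 2 * j.+1).+1)%N by lia.
  by rewrite (exprS y); ring.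
(* Indeed [(j+1)(j+1+s) = j(j+s) + 2j + 1 + s]. *)
have expE : q ^+ (n.+1 + s) * q ^+ (j * (j + s))
    = q ^+ (n - 2 * j) * q ^+ (j.+1 * (j.+1 + s)).
  by rewrite -!exprD; congr (_ ^+ _); nia.
rewrite /qfib_term [RHS](_ : _ = - ((-1) ^+ j * gauss_binom q (n - j) j
  * y ^+ (n - 2 * j) * (q ^+ (n.+1 + s) * q ^+ (j * (j + s))))); last by ring.
by rewrite expE exprS; ring.
Qed.

Lemma qfibSS n : qfib n.+2 = y * qfib n.+1 - q ^+ (n.+1 + s) * qfib n.
Proof.
(* The term [j = n.+2] is zero and the terms [j = 0] agree; the others are matched termwise after a
   shift of [j]. *)
rewrite /qfib big_ord_recr /= qfib_term_small ?addr0; last lia.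
rewrite big_ord_recl [in RHS]big_ord_recl mulrDr -addrA; congr (_ + _).
  by rewrite /qfib_term !gauss_binom0 !muln0 !subn0 (exprS y n.+1); ring.
rewrite !mulr_sumr -sumrB; apply: eq_bigr => j _.
by rewrite -qfib_termS // -ltnS.
Qed.

End FibonacciSum.

Section Expansion.
Variable F : fieldType.
Implicit Types x q : F.

Lemma qMV_E_qfib n x q : qMV_E n.+1 x q = qfib F (x + 1 + q) q 0 n.
Proof.
rewrite -qfib_half /qMV_E subn1; apply: eq_big_nat => j /andP[_ ltj].
rewrite qbinomE /qfib_term; last lia.
have -> : (n.+1 - j - 1 = n - j)%N by lia.
have -> : (n.+1 - 2 * j - 1 = n - 2 * j)%N by lia.
by rewrite addn0 mulnn.
Qed.

Lemma qMV_A_qfib n x q : qMV_A n.+2 x q = - qfib F (x + 1 + q) q 1 n.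
Proof.
rewrite -qfib_half /qMV_A subn2 -sumrN; apply: eq_big_nat => j /andP[_ ltj].
rewrite qbinomE /qfib_term; last lia.
have -> : (n.+2 - j - 2 = n - j)%N by lia.
have -> : (n.+2 - 2 * j - 2 = n - 2 * j)%N by lia.
by rewrite exprD expr1 mulrN1 !mulNr.
Qed.

Lemma qMorganVoyceSS (M0 M1 : F -> F -> F) n x q :
  qMorganVoyce M0 M1 n.+2 x q
  = (x + 1 + q) * qMorganVoyce M0 M1 n.+1 x q
    - q ^+ n * qMorganVoyce M0 M1 n x q.
Proof. by []. Qed.

Lemma qMorganVoyce_qfib (M0 M1 : F -> F -> F) n x q :
  qMorganVoyce M0 M1 n.+2 x q
  = M1 x q * qfib F (x + 1 + q) q 0 n.+1 - M0 x q * qfib F (x + 1 + q) q 1 n.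
Proof.
have [k] := ubnP n; elim: k n => // k IHk [|[|n]] ltk.
- by rewrite qMorganVoyceSS /= qfib1 qfib0; ring.
- by rewrite !qMorganVoyceSS /= qfibSS !qfib1 !qfib0; ring.
rewrite qMorganVoyceSS !IHk; try lia.
(* The index [n.+1] with [s = 0] and the index [n] with [s = 1] yield the same factor [q ^+ n.+2],
   which is also that of the recurrence for [M]. *)
rewrite [in RHS]qfibSS [qfib _ _ _ 1 n.+2]qfibSS.
by rewrite addn0 addn1; ring.
Qed.

End Expansion.

Theorem theorem13 (R : realType) (M0 M1 : R[i] -> R[i] -> R[i]) (x q : R[i])
    (hq : q != 1) (n : nat) (hn : (2 <= n)%N) :
  qMorganVoyce M0 M1 n x q
  = M0 x q * qMV_A n x q + M1 x q * qMV_E n x q.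
Proof.
case: n hn => [|[|n]] // _.
by rewrite qMorganVoyce_qfib qMV_A_qfib qMV_E_qfib mulrN addrC.
Qed.
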